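(* Let $a>0$, $g\in\mathbb R$. The bifurcation diagram of the integrable Hamiltonian system on the orbit $M^4_{a,g}$ with Hamiltonian $$H=\frac12\Bigl(S_1^2+S_2^2+\frac{S_3^2}\beta\Bigr)+g_1(\mathbf R^2,R_3)(S_1R_2-S_2R_1)+g_2(\mathbf R^2,R_3)\langle\mathbf S,\mathbf R\rangle+g_3(\mathbf R^2,R_3)S_3+V(\mathbf R^2,R_3)$$ and integral $K=S_3$ consists of the following subsets of the plane $\mathbb R^2(h,k)$: 1) two points $Z_\pm$ (they can coincide if $g=0$) with coordinates $$h=\frac{g^2}{2\beta a}+g\,g_2(a,\pm\sqrt a)\pm\frac g{\sqrt a}\,g_3(a,\pm\sqrt a)+V(a,\pm\sqrt a),\qquad k=\pm\frac g{\sqrt a},$$ which are the images of the two singular points of rank $0$; 2) the points $(h(x),k(x))$ which are the images of the singular points of rank $1$ and are parametrized by the parameter $x$, $x^2<a$, where the (possibly multivalued) function $k(x)$ is implicitly defined by the quadratic (or linear) in $k$ equation $\frac{\partial W_{a,g}}{\partial x}(k,x)=0$, and $h(x)=W_{a,g}(k(x),x)$. Here $$W_{a,g}(k,x)=\frac{(g-kx)^2}{2(a-x^2)}+\frac{k^2}{2\beta}-\frac{g_1^2(a,x)}2(a-x^2)+g_2(a,x)g+g_3(a,x)k+V(a,x).$$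
   Context: On $\mathrm e(3)^*=\mathbb R^6$ with linear coordinates $(\mathbf S,\mathbf R)=(S_1,S_2,S_3,R_1,R_2,R_3)$ consider the Lie–Poisson bracket $\{S_i,S_j\}=\varepsilon_{ijk}S_k$, $\{S_i,R_j\}=\varepsilon_{ijk}R_k$, $\{R_i,R_j\}=0$. For a smooth function $f$, $\mathrm{sgrad} f$ is the Hamiltonian vector field $\dot x_i=\{x_i,f\}$. For $a>0$, $M^4_{a,g}=\{\langle\mathbf R,\mathbf R\rangle=a,\ \langle\mathbf S,\mathbf R\rangle=g\}$ is a symplectic leaf; $\mathbf R^2=\langle\mathbf R,\mathbf R\rangle$. In the Hamiltonian, $\beta>0$ is a constant and $g_1,g_2,g_3,V$ are smooth functions of two variables $(a,x)$ (the values of $\mathbf R^2$ and $R_3$) in the range $a>0$, $x^2\le a$. A singular point of rank $r\in\{0,1\}$ is a point where the span of $\mathrm{sgrad} H$, $\mathrm{sgrad} K$ has dimension $r$. The bifurcation diagram is the image in $\mathbb R^2(h,k)$ of the set of all singular points (rank $0$ and $1$) in $M^4_{a,g}$ under the momentum mapping $(H,K):M^4_{a,g}\to\mathbb R^2(h,k)$. *)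

(* Defs.v *)
From HB Require Import structures.
From mathcomp Require Import all_boot all_order all_algebra.
From mathcomp Require Import all_classical all_reals all_analysis.

Set Implicit Arguments.
Unset Strict Implicit.
Unset Printing Implicit Defensive.

Import Order.TTheory GRing.Theory Num.Theory.
Import numFieldNormedType.Exports.

Local Open Scope classical_set_scope.
Local Open Scope ring_scope.

Fixpoint Ck (R : realType) (n : nat) (U : set (R * R)) (f : R * R -> R) : Prop :=
  if n is m.+1 then
    (forall p, U p -> differentiable f p) /\ (forall v, Ck m U ('D_v f))
  else forall p, U p -> {for p, continuous f}.

(* Smoothness on a set that need not be open: near each of its points, [f]
   agrees on [D] with a C^oo function defined on an open neighbourhood.  The
   values of [f] outside [D] are irrelevant. *)
Definition smooth_on (R : realType) (D : set (R * R)) (f : R * R -> R) : Prop :=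
  forall p, D p -> exists (U : set (R * R)) (F : R * R -> R),
    [/\ open U, U p, (forall n, Ck n U F) & forall q, U q -> D q -> f q = F q].

(* The possible values (a, x) of (<R,R>, R_3) on the region R != 0. *)
Definition range_aR3 (R : realType) : set (R * R) :=
  [set p | 0 < p.1 /\ p.2 ^+ 2 <= p.1].

(* A point of e(3)^* is the row (S_1, S_2, S_3, R_1, R_2, R_3); the indices
   1, 2, 3 of the mathematical notation are 0, 1, 2 : 'I_3. *)
Definition phase (R : realType) := 'rV[R]_(3 + 3).

Definition vS (R : realType) (p : phase R) : 'rV[R]_3 := lsubmx p.
Definition vR (R : realType) (p : phase R) : 'rV[R]_3 := rsubmx p.

Definition dot3 (R : realType) (u v : 'rV[R]_3) : R := \sum_(i < 3) u 0 i * v 0 i.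

(* Levi-Civita symbol; index arithmetic is modulo 3. *)
Definition levi_civita (R : realType) (i j k : 'I_3) : R :=
  ((j == i + 1) && (k == i + 2))%:R - ((j == i + 2) && (k == i + 1))%:R.

Definition eps_mx (R : realType) (v : 'rV[R]_3) : 'M[R]_3 :=
  \matrix_(i, j) \sum_(k < 3) levi_civita R i j k * v 0 k.

(* The brackets {x_i, x_j} of the coordinate functions. *)
Definition poisson_mx (R : realType) (p : phase R) : 'M[R]_(3 + 3) :=
  block_mx (eps_mx (vS p)) (eps_mx (vR p)) (eps_mx (vR p)) 0.

Definition partial (R : realType) (j : 'I_(3 + 3)) (f : phase R -> R)
    (p : phase R) : R :=
  'D_(delta_mx 0 j : phase R) f p.

Definition poisson (R : realType) (f h : phase R -> R) (p : phase R) : R :=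
  \sum_i \sum_j poisson_mx p i j * partial i f p * partial j h p.

Definition sgrad (R : realType) (f : phase R -> R) (p : phase R) : 'rV[R]_(3 + 3) :=
  \row_i poisson (fun q : phase R => q 0 i) f p.

Definition leaf (R : realType) (a g : R) : set (phase R) :=
  [set p | dot3 (vR p) (vR p) = a /\ dot3 (vS p) (vR p) = g].

Definition hamiltonian (R : realType) (beta : R) (g1 g2 g3 V : R * R -> R)
    (p : phase R) : R :=
  let S1 := vS p 0 0 in let S2 := vS p 0 1 in let S3 := vS p 0 2 in
  let R1 := vR p 0 0 in let R2 := vR p 0 1 in let R3 := vR p 0 2 in
  let ax := (dot3 (vR p) (vR p), R3) in
  (S1 ^+ 2 + S2 ^+ 2 + S3 ^+ 2 / beta) / 2 + g1 ax * (S1 * R2 - S2 * R1)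
  + g2 ax * dot3 (vS p) (vR p) + g3 ax * S3 + V ax.

Definition integralK (R : realType) (p : phase R) : R := vS p 0 2.

Definition momentum (R : realType) (H K : phase R -> R) (p : phase R) : R * R :=
  (H p, K p).

(* Points of the leaf where the span of sgrad H and sgrad K has dimension r;
   they are the singular points of rank r when r is 0 or 1. *)
Definition rank_set (R : realType) (a g : R) (H K : phase R -> R) (r : nat) :
    set (phase R) :=
  [set p | leaf a g p /\ \rank (col_mx (sgrad H p) (sgrad K p)) = r].

Definition bifurcation_diagram (R : realType) (a g : R) (H K : phase R -> R) :
    set (R * R) :=
  momentum H K @` (rank_set a g H K 0 `|` rank_set a g H K 1).

(* Z_+ and Z_- are obtained for s = 1 and s = -1. *)
Definition Zpoint (R : realType) (a g beta : R) (g2 g3 V : R * R -> R) (s : R) :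
    R * R :=
  let ax := (a, s * Num.sqrt a) in
  (g ^+ 2 / (2 * beta * a) + g * g2 ax + s * (g / Num.sqrt a) * g3 ax + V ax,
   s * (g / Num.sqrt a)).

Definition Wag (R : realType) (a g beta : R) (g1 g2 g3 V : R * R -> R) (k x : R) : R :=
  (g - k * x) ^+ 2 / (2 * (a - x ^+ 2)) + k ^+ 2 / (2 * beta)
  - g1 (a, x) ^+ 2 / 2 * (a - x ^+ 2) + g2 (a, x) * g + g3 (a, x) * k + V (a, x).

Definition dWdx (R : realType) (a g beta : R) (g1 g2 g3 V : R * R -> R) (k x : R) : R :=
  derive1 (Wag a g beta g1 g2 g3 V k) x.

Definition rank1_curve (R : realType) (a g beta : R) (g1 g2 g3 V : R * R -> R) :
    set (R * R) :=
  [set hk | exists x k, [/\ x ^+ 2 < a, dWdx a g beta g1 g2 g3 V k x = 0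
                          & hk = (Wag a g beta g1 g2 g3 V k x, k)]].

(* Main.v *)
(** K generates the rotations about the third axis, so sgrad K vanishes exactly
on the axis S_1 = S_2 = R_1 = R_2 = 0, which meets the leaf in two points; there
sgrad H vanishes as well.  Elsewhere rank 1 means sgrad H = l sgrad K.  If
R_1 = R_2 = 0, this forces S_1 = S_2 = 0; so R_3^2 < a, and the R-part of the
equation says that S_1 R_2 - S_2 R_1 = - g_1 (a - R_3^2) and determines l.  What
remains of the S-part is dW/dx = 0 at k = S_3, x = R_3, and on these points
H = W.  Conversely (k, x) is realised by R = (rho, 0, x),
S = ((g - k x) / rho, g_1 rho, k) with rho^2 = a - x^2. *)

Require Import Defs.
From mathcomp Require Import all_boot all_order all_algebra.
From mathcomp Require Import all_classical all_reals all_analysis.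
From mathcomp Require Import ring lra.
Import Order.TTheory GRing.Theory Num.Theory.
Import numFieldNormedType.Exports.
Local Open Scope classical_set_scope.
Local Open Scope ring_scope.

(** * Derivatives of the coefficients, of H and of W *)

(* Only curves inside [D] are tested, because [f] itself need not be
   differentiable at a boundary point of [D]. *)
Definition has_partials {R : realType} (D : set (R * R)) (f : R * R -> R)
    (p : R * R) (fa fx : R) : Prop :=
  forall (A X : R -> R) (t A' X' : R),
    (A t, X t) = p -> is_derive t 1 A A' -> is_derive t 1 X X' ->
    (\forall s \near t, D (A s, X s)) ->
    is_derive t 1 (fun s => f (A s, X s)) (fa * A' + fx * X').

(** Near [p] the function [f] coincides on [D] with a differentiable [F], so along a curve that
    stays in [D] the chain rule for [F] applies to [f]. The two numbers are the values of ['d F p]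
    on the standard basis; at a boundary point they come from the chosen extension. *)
Lemma smooth_on_has_partials {R : realType} {D : set (R * R)} {f : R * R -> R}
    {p : R * R} :
  smooth_on D f -> D p -> exists fa fx : R, has_partials D f p fa fx.
Proof.
move=> smooth_f Dp; have [U [F [openU Up smoothF fF]]] := smooth_f p Dp.
have [/(_ p Up) diffF _] := smoothF 1%N.
exists ('d F p (1, 0)), ('d F p (0, 1)) => A X t A' X' AXp dA dX nearD.
have diffA : differentiable A t by apply/derivable1_diffP; case: dA.
have diffX : differentiable X t by apply/derivable1_diffP; case: dX.
pose c s := (A s, X s).
have diffc : differentiable c t by exact: differentiable_pair.
have nearU : \forall s \near t, U (c s).
  apply: (differentiable_continuous diffc).
  by rewrite /= /c AXp; exact: open_nbhs_nbhs.
apply: (@near_eq_is_derive _ _ _ (F \o c)).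
  near=> s; rewrite /= -/(c s); apply/esym/fF; last by near: s.
  by near: s.
have diffFc : differentiable F (c t) by rewrite /c AXp.
have diffFoc : differentiable (F \o c) t by exact: differentiable_comp.
apply: DeriveDef; first exact: diff_derivable.
rewrite deriveE// diff_comp//=.
have -> : 'd c t (1 : R) = (A', X').
  have -> : 'd c t (1 : R) = ('d A t (1 : R), 'd X t (1 : R)).
    by rewrite (diff_pair diffA diffX).
  by rewrite -!deriveE//; case: dA => _ ->; case: dX => _ ->.
rewrite /c AXp.
have -> : (A', X') = A' *: (1, 0) + X' *: (0, 1) :> R * R.
  by congr pair; rewrite /= /GRing.scale /= ?mulr1 ?mulr0 ?addr0 ?add0r.
by rewrite linearD !linearZ /= /GRing.scale /= !(mulrC _ ('d F p _)).
Unshelve. all: by end_near. Qed.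

(** Both derivatives are limits of the same difference quotient. This passes from directional
    derivatives in phase space to functions of one real variable, where [is_derive] is found by
    instance search. *)
Lemma derive_along_line {R : numFieldType} {V W : normedModType R} (f : V -> W)
    (x v : V) (df : W) :
  is_derive (0 : R) 1 (fun t : R => f (t *: v + x)) df -> 'D_v f x = df.
Proof.
case=> _ <-; rewrite /derive.
set g1 := fun h => h^-1 *: _; set g2 := fun h => h^-1 *: _.
suff -> : g1 = g2 by [].
by rewrite funeqE /g1 /g2 => h /=; rewrite addr0 scale0r add0r [_%:A]mulr1.
Qed.

Lemma sum_I3 {V : nmodType} (F : 'I_3 -> V) :
  \sum_i F i = F 0 + F 1 + F 2.
Proof.
rewrite !big_ord_recl big_ord0 addr0 addrA.
by congr (_ + F _ + F _); apply: val_inj.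
Qed.

Lemma dot3E {R : realType} (u v : 'rV[R]_3) :
  dot3 u v = u 0 0 * v 0 0 + u 0 1 * v 0 1 + u 0 2 * v 0 2.
Proof. exact: sum_I3. Qed.

Lemma derive_hamiltonian {R : realType} {beta : R} {g1 g2 g3 V : R * R -> R}
    {p : phase R} (v : phase R) {ga1 gx1 ga2 gx2 ga3 gx3 Va Vx : R} :
  let S := vS p in let P := vR p in let ax := (dot3 P P, P 0 2) in
  let u := vS v in let w := vR v in
  0 < dot3 P P ->
  has_partials (@range_aR3 R) g1 ax ga1 gx1 ->
  has_partials (@range_aR3 R) g2 ax ga2 gx2 ->
  has_partials (@range_aR3 R) g3 ax ga3 gx3 ->
  has_partials (@range_aR3 R) V ax Va Vx ->
  let L := S 0 0 * P 0 1 - S 0 1 * P 0 0 in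
  'D_v (hamiltonian beta g1 g2 g3 V) p =
    (S 0 0 * u 0 0 + S 0 1 * u 0 1 + S 0 2 * u 0 2 / beta)
    + g1 ax * (u 0 0 * P 0 1 + S 0 0 * w 0 1 - u 0 1 * P 0 0 - S 0 1 * w 0 0)
    + g2 ax * (dot3 u P + dot3 S w) + g3 ax * u 0 2
    + (ga1 * L + ga2 * dot3 S P + ga3 * S 0 2 + Va) * (2 * dot3 P w)
    + (gx1 * L + gx2 * dot3 S P + gx3 * S 0 2 + Vx) * w 0 2.
Proof.
move=> S P ax u w P_gt0 dg1 dg2 dg3 dV L; apply: derive_along_line.
pose s i (t : R) := t * u 0 i + S 0 i.
pose r i (t : R) := t * w 0 i + P 0 i.
pose A (t : R) := r 0 t * r 0 t + r 1 t * r 1 t + r 2 t * r 2 t.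
have dr i : is_derive (0 : R) 1 (r i) (w 0 i).
  by rewrite /r; apply: is_derive_eq; rewrite /GRing.scale /=; ring.
have dA : is_derive (0 : R) 1 A (2 * dot3 P w).
  by rewrite /A; apply: is_derive_eq; rewrite dot3E /GRing.scale /= /r; ring.
have ds i : is_derive (0 : R) 1 (s i) (u 0 i).
  by rewrite /s; apply: is_derive_eq; rewrite /GRing.scale /=; ring.
have A0 : A 0 = dot3 P P by rewrite /A /r dot3E; ring.
have ax0 : (A 0, r 2 0) = ax by rewrite A0 /r mul0r add0r.
(* The bound R_3^2 <= <R,R> holds everywhere, and <R,R> stays positive near [t = 0]. Hence the line
   never leaves the range, even when it starts on the boundary x^2 = a, that is, at R_1 = R_2 =
   0. *)
have nearD : \forall t \near 0, range_aR3 (A t, r 2 t).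
  have : \forall t \near 0, 0 < A t.
    have contA : {for 0, continuous A}.
      by apply/differentiable_continuous/derivable1_diffP; case: dA.
    by apply: (cvgr_gt _ contA); rewrite A0.
  apply: filterS => t A_gt0; split => //=.
  by rewrite /A -!expr2 lerDr addr_ge0 ?sqr_ge0.
have := dg1 _ _ _ _ _ ax0 dA (dr 2) nearD.
have := dg2 _ _ _ _ _ ax0 dA (dr 2) nearD.
have := dg3 _ _ _ _ _ ax0 dA (dr 2) nearD.
have := dV _ _ _ _ _ ax0 dA (dr 2) nearD.
set GV := fun _ => V _; set G3 := fun _ => g3 _; set G2 := fun _ => g2 _.
set G1 := fun _ => g1 _ => dGV dG3 dG2 dG1.
have -> : (fun t : R => hamiltonian beta g1 g2 g3 V (t *: v + p)) =
    (fun t => (s 0 t ^+ 2 + s 1 t ^+ 2 + s 2 t ^+ 2 / beta) / 2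
     + G1 t * (s 0 t * r 1 t - s 1 t * r 0 t)
     + G2 t * (s 0 t * r 0 t + s 1 t * r 1 t + s 2 t * r 2 t) + G3 t * s 2 t
     + GV t).
  apply/funext => t.
  have sE i : vS (t *: v + p) 0 i = s i t by rewrite /s /S /u /vS !mxE.
  have rE i : vR (t *: v + p) 0 i = r i t by rewrite /r /P /w /vR !mxE.
  by rewrite /hamiltonian !dot3E !sE !rE.
apply: is_derive_eq.
have -> : g1 ax = G1 0 by rewrite /G1 ax0.
have -> : g2 ax = G2 0 by rewrite /G2 ax0.
have -> : g3 ax = G3 0 by rewrite /G3 ax0.
have s0 i : s i 0 = S 0 i by rewrite /s mul0r add0r.
have r0 i : r i 0 = P 0 i by rewrite /r mul0r add0r.
rewrite !dot3E /L /GRing.scale /= !s0 !r0 {A0 ax0}.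
(* The identity is polynomial in [beta^-1]; once this is a variable, only numerical denominators
   remain. *)
by move: beta^-1 => b; field.
Qed.

(** The curve tested is s -> (a, s), with constant first coordinate, so only the derivatives in x
    survive. It stays in the range near [x] because the inequality x^2 < a is strict. *)
Lemma derive1_Wag {R : realType} {a g beta : R} {g1 g2 g3 V : R * R -> R}
    {x ga1 gx1 ga2 gx2 ga3 gx3 Va Vx : R} (k : R) :
  x ^+ 2 < a ->
  has_partials (@range_aR3 R) g1 (a, x) ga1 gx1 ->
  has_partials (@range_aR3 R) g2 (a, x) ga2 gx2 ->
  has_partials (@range_aR3 R) g3 (a, x) ga3 gx3 ->
  has_partials (@range_aR3 R) V (a, x) Va Vx ->
  dWdx a g beta g1 g2 g3 V k x =
    x * (g - k * x) ^+ 2 / (a - x ^+ 2) ^+ 2 - k * (g - k * x) / (a - x ^+ 2)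
    + g1 (a, x) ^+ 2 * x - g1 (a, x) * gx1 * (a - x ^+ 2)
    + gx2 * g + gx3 * k + Vx.
Proof.
move=> x2a dg1 dg2 dg3 dV; rewrite /dWdx derive1E.
have da : is_derive x (1 : R) (cst a) 0 by exact: is_derive_cst.
have dx : is_derive x (1 : R) id 1 by exact: is_derive_id.
have nearD : \forall s \near x, range_aR3 (cst a s, id s).
  have a_gt0 : 0 < a := le_lt_trans (sqr_ge0 x) x2a.
  have contx2 : {for x, continuous (fun s : R => s ^+ 2)}.
    exact: exprn_continuous.
  have : \forall s \near x, s ^+ 2 < a by exact: (cvgr_lt _ contx2 a x2a).
  by apply: filterS => s s2a; split; [exact: a_gt0|exact: ltW].
have := dg1 _ _ _ _ _ erefl da dx nearD.
have := dg2 _ _ _ _ _ erefl da dx nearD.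
have := dg3 _ _ _ _ _ erefl da dx nearD.
have := dV _ _ _ _ _ erefl da dx nearD.
set GV := fun _ => V _; set G3 := fun _ => g3 _; set G2 := fun _ => g2 _.
set G1 := fun _ => g1 _ => dGV dG3 dG2 dG1.
have den_neq0 : 2 * (a - x ^+ 2) != 0.
  by rewrite mulf_neq0 ?pnatr_eq0// subr_eq0 gt_eqF.
have -> : Wag a g beta g1 g2 g3 V k =
    (fun s => (g - k * s) ^+ 2 * (2 * (a - s ^+ 2))^-1 + k ^+ 2 / (2 * beta)
     - G1 s ^+ 2 / 2 * (a - s ^+ 2) + G2 s * g + G3 s * k + GV s) by [].
have dden : is_derive x (1 : R) (fun s => 2 * (a - s ^+ 2)) (- 4 * x).
  by apply: is_derive_eq; rewrite /GRing.scale /=; ring.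
have dV' := @is_deriveV _ (fun s => 2 * (a - s ^+ 2)) _ _ _ den_neq0 dden.
apply: derive_val; apply: is_derive_eq.
rewrite /GRing.scale /= -/(G1 x).
have := den_neq0; rewrite mulf_eq0 pnatr_eq0 /= => den'_neq0.
by field.
Qed.

(** * Hamiltonian vector fields in coordinates *)

Definition row3 {R : nzRingType} (a b c : R) : 'rV[R]_3 :=
  \row_i [:: a; b; c]`_i.

Lemma row3P {R : nzRingType} (u : 'rV[R]_3) : u = row3 (u 0 0) (u 0 1) (u 0 2).
Proof.
apply/rowP => i; rewrite mxE.
by case: i => [[|[|[|//]]] Hi] /=; congr (u 0 _); apply: val_inj.
Qed.

Lemma row3K {R : nzRingType} (a b c : R) :
  (row3 a b c 0 0 = a) * (row3 a b c 0 1 = b) * (row3 a b c 0 2 = c).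
Proof. by rewrite !mxE. Qed.

Lemma scale_row3 {R : nzRingType} (l a b c : R) :
  l *: row3 a b c = row3 (l * a) (l * b) (l * c).
Proof. by rewrite [LHS]row3P !mxE. Qed.

Lemma row3D {R : nzRingType} (a b c a' b' c' : R) :
  row3 a b c + row3 a' b' c' = row3 (a + a') (b + b') (c + c').
Proof. by rewrite [LHS]row3P !mxE. Qed.

Lemma row3_0 {R : nzRingType} : row3 0 0 0 = 0 :> 'rV[R]_3.
Proof. by rewrite [RHS]row3P !mxE. Qed.

Lemma row3_inj {R : nzRingType} (a b c a' b' c' : R) :
  row3 a b c = row3 a' b' c' -> [/\ a = a', b = b' & c = c'].
Proof. by move=> e; move: (row3K a b c); rewrite e !row3K => -[[-> ->] ->]. Qed.

Definition cross3 {R : nzRingType} (u v : 'rV[R]_3) : 'rV[R]_3 :=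
  row3 (u 0 1 * v 0 2 - u 0 2 * v 0 1) (u 0 2 * v 0 0 - u 0 0 * v 0 2)
       (u 0 0 * v 0 1 - u 0 1 * v 0 0).

Lemma eps_mx_cross {R : realType} (u v : 'rV[R]_3) i :
  \sum_j eps_mx v i j * u 0 j = cross3 u v 0 i.
Proof.
rewrite sum_I3 !mxE !sum_I3 /levi_civita.
case: i => [[|[|[|//]]] Hi] /=; ring.
Qed.

Definition gradS {R : realType} (f : phase R -> R) (p : phase R) : 'rV[R]_3 :=
  \row_i partial (lshift 3 i) f p.

Definition gradR {R : realType} (f : phase R -> R) (p : phase R) : 'rV[R]_3 :=
  \row_i partial (rshift 3 i) f p.

Lemma partial_coord {R : realType} (i j : 'I_(3 + 3)) (p : phase R) :
  partial j (fun q : phase R => q 0 i) p = (i == j)%:R.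
Proof.
apply: derive_along_line.
have -> : (fun t : R => (t *: (delta_mx 0 j : phase R) + p) 0 i) =
          (fun t => t * (i == j)%:R + p 0 i).
  by apply/funext => t; rewrite !mxE eqxx.
by apply: is_derive_eq; rewrite /GRing.scale /=; ring.
Qed.

(** These are Kirchhoff's equations. The gradient of a coordinate function is a basis vector, so the
    double sum of the bracket collapses to the Poisson matrix applied to the gradient of [f], and
    each nonzero block acts as a vector product. *)
Lemma sgradE {R : realType} (f : phase R -> R) (p : phase R) :
  sgrad f p = row_mx (cross3 (gradS f p) (vS p) + cross3 (gradR f p) (vR p))
                     (cross3 (gradS f p) (vR p)).
Proof.
have sgrad_coord i : sgrad f p 0 i = \sum_j poisson_mx p i j * partial j f p.
  rewrite mxE /poisson (bigD1 i)//= [X in _ + X]big1 ?addr0.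
    by apply: eq_bigr => j _; rewrite partial_coord eqxx mulr1.
  move=> k ki; apply: big1 => j _.
  by rewrite partial_coord eq_sym (negbTE ki) mulr0 mul0r.
apply/rowP => i; rewrite sgrad_coord big_split_ord /=.
case: (split_ordP i) => {}i ->.
  rewrite row_mxEl mxE -!eps_mx_cross; congr (_ + _); apply: eq_bigr => j _.
    by rewrite /poisson_mx block_mxEul !mxE.
  by rewrite /poisson_mx block_mxEur !mxE.
rewrite row_mxEr -!eps_mx_cross [X in _ + X]big1 ?addr0 => [|j _].
  by apply: eq_bigr => j _; rewrite /poisson_mx block_mxEdl !mxE.
by rewrite /poisson_mx block_mxEdr !mxE mul0r.
Qed.

Lemma delta_coord {R : realType} (i j : 'I_3) :
  (vS (delta_mx 0 (lshift 3 i) : phase R) 0 j = (j == i)%:R) *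
  (vS (delta_mx 0 (rshift 3 i) : phase R) 0 j = 0) *
  (vR (delta_mx 0 (lshift 3 i) : phase R) 0 j = 0) *
  (vR (delta_mx 0 (rshift 3 i) : phase R) 0 j = (j == i)%:R).
Proof.
by rewrite /vS /vR !mxE !eqxx /= (inj_eq (@lshift_inj _ _))
  (inj_eq (@rshift_inj _ _)) eq_lrshift eq_rlshift.
Qed.

(* [g2] and the derivatives in the first variable drop out, because they multiply
   the gradients of the Casimirs <S,R> and <R,R>. *)
Lemma sgrad_hamiltonian {R : realType} {beta : R} {g1 g2 g3 V : R * R -> R}
    {p : phase R} {ga1 gx1 ga2 gx2 ga3 gx3 Va Vx : R} :
  let s1 := vS p 0 0 in let s2 := vS p 0 1 in let s3 := vS p 0 2 in
  let r1 := vR p 0 0 in let r2 := vR p 0 1 in let r3 := vR p 0 2 in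
  let ax := (dot3 (vR p) (vR p), r3) in
  0 < dot3 (vR p) (vR p) ->
  has_partials (@range_aR3 R) g1 ax ga1 gx1 ->
  has_partials (@range_aR3 R) g2 ax ga2 gx2 ->
  has_partials (@range_aR3 R) g3 ax ga3 gx3 ->
  has_partials (@range_aR3 R) V ax Va Vx ->
  let c := s3 / beta + g3 ax in
  let e := gx1 * (s1 * r2 - s2 * r1) + gx2 * dot3 (vS p) (vR p) + gx3 * s3 + Vx in
  sgrad (hamiltonian beta g1 g2 g3 V) p =
    row_mx
      (row3 ((s2 - g1 ax * r1) * s3 - c * s2 + g1 ax * s1 * r3 - e * r2)
            (c * s1 - (s1 + g1 ax * r2) * s3 + g1 ax * s2 * r3 + e * r1)
            0)
      (row3 ((s2 - g1 ax * r1) * r3 - c * r2)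
            (c * r1 - (s1 + g1 ax * r2) * r3)
            (s1 * r2 - s2 * r1 + g1 ax * (r1 ^+ 2 + r2 ^+ 2))).
Proof.
move=> s1 s2 s3 r1 r2 r3 ax r_gt0 dg1 dg2 dg3 dV c e.
have := fun v => derive_hamiltonian v r_gt0 dg1 dg2 dg3 dV.
rewrite /= /c /e -/ax; move: (g1 ax) (g2 ax) (g3 ax) => G1 G2 G3 dH.
rewrite !dot3E -/s1 -/s2 -/s3 -/r1 -/r2 -/r3.
set ex := gx1 * _ + _ + _ + _.
(* The derivative of H in the variable a. It enters [gradR] as a multiple of R, which the product
   with R kills; likewise the [G2] terms contribute G2 (R x S + S x R) = 0 and G2 (R x R) = 0. *)
pose ea := ga1 * (s1 * r2 - s2 * r1) + ga2 * (s1 * r1 + s2 * r2 + s3 * r3)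
  + ga3 * s3 + Va.
have OSE i : gradS (hamiltonian beta g1 g2 g3 V) p 0 i =
    s1 * (0 == i)%:R + s2 * (1 == i)%:R + s3 * (2 == i)%:R / beta
    + G1 * ((0 == i)%:R * r2 - (1 == i)%:R * r1)
    + G2 * ((0 == i)%:R * r1 + (1 == i)%:R * r2 + (2 == i)%:R * r3)
    + G3 * (2 == i)%:R.
  rewrite mxE /partial dH !dot3E !delta_coord.
  by rewrite -/s1 -/s2 -/s3 -/r1 -/r2 -/r3; ring.
have ORE i : gradR (hamiltonian beta g1 g2 g3 V) p 0 i =
    G1 * (s1 * (1 == i)%:R - s2 * (0 == i)%:R)
    + G2 * (s1 * (0 == i)%:R + s2 * (1 == i)%:R + s3 * (2 == i)%:R)
    + ea * (2 * (r1 * (0 == i)%:R + r2 * (1 == i)%:R + r3 * (2 == i)%:R))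
    + ex * (2 == i)%:R.
  rewrite mxE /partial dH !dot3E !delta_coord.
  by rewrite -/s1 -/s2 -/s3 -/r1 -/r2 -/r3 /ea /ex; ring.
rewrite sgradE; move: (gradS _ p) (gradR _ p) OSE ORE => OS OR OSE ORE.
congr row_mx.
  by rewrite /cross3 row3D; congr row3; rewrite !OSE !ORE /=;
    rewrite -/s1 -/s2 -/s3 -/r1 -/r2 -/r3; ring.
by rewrite /cross3; congr row3; rewrite !OSE /=;
  rewrite -/s1 -/s2 -/s3 -/r1 -/r2 -/r3; ring.
Qed.

Lemma sgrad_integralK {R : realType} (p : phase R) :
  sgrad (@integralK R) p =
    row_mx (row3 (- vS p 0 1) (vS p 0 0) 0) (row3 (- vR p 0 1) (vR p 0 0) 0).
Proof.
have pS j : partial j (@integralK R) p = (lshift 3 2 == j)%:R.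
  have -> : @integralK R = (fun q => q 0 (lshift 3 2)).
    by apply/funext => q; rewrite /integralK /vS mxE.
  exact: partial_coord.
have gS i : gradS (@integralK R) p 0 i = (2 == i)%:R.
  by rewrite mxE pS (inj_eq (@lshift_inj _ _)).
have gR i : gradR (@integralK R) p 0 i = 0 by rewrite mxE pS eq_lrshift.
rewrite sgradE; move: (gradS _ p) (gradR _ p) gS gR => OS OR gS gR.
congr row_mx.
  by rewrite /cross3 row3D; congr row3; rewrite !gS !gR /=; ring.
by rewrite /cross3; congr row3; rewrite !gS /=; ring.
Qed.

(** * Singular points of rank 0 and 1 *)

Lemma rank_pair0 {F : fieldType} {n : nat} (u v : 'rV[F]_n) :
  \rank (col_mx u v) = 0%N <-> u = 0 /\ v = 0.
Proof.
split=> [/eqP|[-> ->]]; last by rewrite col_mx0 mxrank0.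
by rewrite mxrank_eq0 col_mx_eq0 => /andP[/eqP -> /eqP ->].
Qed.

(** The row space of [v] has dimension 1 and lies in that of the pair. The ranks agree exactly when
    the two spaces do, that is, when [u] lies on the line of [v]. *)
Lemma rank_pair1 {F : fieldType} {n : nat} (u v : 'rV[F]_n) :
  v != 0 -> \rank (col_mx u v) = 1%N <-> exists l, u = l *: v.
Proof.
move=> v_neq0; have rv : \rank v = 1%N by rewrite rank_rV v_neq0.
have vuv : (v <= col_mx u v)%MS by rewrite -addsmxE addsmxSr.
have [_] := mxrank_leqif_sup vuv; rewrite rv col_mx_sub submx_refl andbT => e.
split=> [r1|/sub_rVP uv]; last by apply/eqP; rewrite eq_sym e.
by apply/sub_rVP; rewrite -e r1.
Qed.

Lemma row_mx_row3_inj {R : nzRingType} (a b c d e f a' b' c' d' e' f' : R) :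
  row_mx (row3 a b c) (row3 d e f) = row_mx (row3 a' b' c') (row3 d' e' f') ->
  [/\ a = a', b = b' & c = c'] /\ [/\ d = d', e = e' & f = f'].
Proof. by case/eq_row_mx => /row3_inj ? /row3_inj. Qed.

Lemma leafE {R : realType} (a g : R) (p : phase R) :
  leaf a g p <->
  a = vR p 0 0 ^+ 2 + vR p 0 1 ^+ 2 + vR p 0 2 ^+ 2 /\
  g = vS p 0 0 * vR p 0 0 + vS p 0 1 * vR p 0 1 + vS p 0 2 * vR p 0 2.
Proof. by rewrite /leaf /= !dot3E -!expr2; split=> -[-> ->]. Qed.

Lemma sgrad_integralK_eq0 {R : realType} (p : phase R) :
  sgrad (@integralK R) p = 0 <->
  [/\ vS p 0 0 = 0, vS p 0 1 = 0, vR p 0 0 = 0 & vR p 0 1 = 0].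
Proof.
rewrite sgrad_integralK -(@row_mx0 _ 1 3 3) -row3_0.
split=> [/row_mx_row3_inj[[/eqP + -> _] [/eqP + -> _]]|[-> -> -> ->]].
  by rewrite !oppr_eq0 => /eqP -> /eqP ->.
by rewrite oppr0.
Qed.

(** All derivatives of the coefficients are hidden in [c] and [e], and the point is that the same
    [e] occurs in sgrad H and in dW/dx. The two agree only under the relation on S_1 R_2 - S_2 R_1,
    since [e] contains this expression times the x-derivative of [g1], while dW/dx has - g_1 (a -
    x^2) in its place. *)
Lemma sgrad_hamiltonian_leaf {R : realType} {a g : R} (beta : R)
    {g1 g2 g3 V : R * R -> R} {p : phase R} :
  let s1 := vS p 0 0 in let s2 := vS p 0 1 in let s3 := vS p 0 2 in
  let r1 := vR p 0 0 in let r2 := vR p 0 1 in let r3 := vR p 0 2 in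
  0 < a ->
  smooth_on (@range_aR3 R) g1 -> smooth_on (@range_aR3 R) g2 ->
  smooth_on (@range_aR3 R) g3 -> smooth_on (@range_aR3 R) V ->
  leaf a g p ->
  let G := g1 (a, r3) in
  exists c e : R,
    sgrad (hamiltonian beta g1 g2 g3 V) p =
      row_mx (row3 ((s2 - G * r1) * s3 - c * s2 + G * s1 * r3 - e * r2)
                   (c * s1 - (s1 + G * r2) * s3 + G * s2 * r3 + e * r1)
                   0)
             (row3 ((s2 - G * r1) * r3 - c * r2)
                   (c * r1 - (s1 + G * r2) * r3)
                   (s1 * r2 - s2 * r1 + G * (r1 ^+ 2 + r2 ^+ 2)))
    /\ (r3 ^+ 2 < a -> s1 * r2 - s2 * r1 = - (G * (a - r3 ^+ 2)) ->
        dWdx a g beta g1 g2 g3 V s3 r3 =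
          r3 * (g - s3 * r3) ^+ 2 / (a - r3 ^+ 2) ^+ 2
          - s3 * (g - s3 * r3) / (a - r3 ^+ 2) + G ^+ 2 * r3 + e).
Proof.
move=> s1 s2 s3 r1 r2 r3 a_gt0 sg1 sg2 sg3 sV leafp G.
have [dRR dSR] := leafp; have [aE _] := (leafE _ _ _).1 leafp.
have Dp : range_aR3 (a, r3).
  by split=> //=; rewrite aE -/r3 lerDr addr_ge0 ?sqr_ge0.
have [ga1 [gx1 dg1]] := smooth_on_has_partials sg1 Dp.
have [ga2 [gx2 dg2]] := smooth_on_has_partials sg2 Dp.
have [ga3 [gx3 dg3]] := smooth_on_has_partials sg3 Dp.
have [Va [Vx dV]] := smooth_on_has_partials sV Dp.
rewrite /G -dRR in a_gt0 dg1 dg2 dg3 dV *.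
do 2 eexists; split; first exact: (sgrad_hamiltonian a_gt0 dg1 dg2 dg3 dV).
move=> r3a L; rewrite (derive1_Wag s3 r3a dg1 dg2 dg3 dV) -/s1 -/s2 -/s3 -/r1.
by rewrite -/r2 -/r3 L dSR; ring.
Qed.

(** Every term of sgrad H carries a factor S_1, S_2, R_1 or R_2, so sgrad H vanishes wherever sgrad
    K does. *)
Lemma rank_eq0P {R : realType} {a g : R} (beta : R) {g1 g2 g3 V : R * R -> R}
    {p : phase R} :
  0 < a ->
  smooth_on (@range_aR3 R) g1 -> smooth_on (@range_aR3 R) g2 ->
  smooth_on (@range_aR3 R) g3 -> smooth_on (@range_aR3 R) V ->
  leaf a g p ->
  \rank (col_mx (sgrad (hamiltonian beta g1 g2 g3 V) p)
                (sgrad (@integralK R) p)) = 0%N <->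
  [/\ vS p 0 0 = 0, vS p 0 1 = 0, vR p 0 0 = 0 & vR p 0 1 = 0].
Proof.
move=> a_gt0 sg1 sg2 sg3 sV leafp.
rewrite rank_pair0 -sgrad_integralK_eq0; split=> [[]//|K0]; split=> //.
have [c [e [-> _]]] := sgrad_hamiltonian_leaf beta a_gt0 sg1 sg2 sg3 sV leafp.
have [-> -> -> ->] := (sgrad_integralK_eq0 p).1 K0.
by rewrite -[RHS]row_mx0 -row3_0; congr row_mx; congr row3; ring.
Qed.

Lemma rank_eq1P {R : realType} {a g : R} (beta : R) {g1 g2 g3 V : R * R -> R}
    {p : phase R} :
  let s1 := vS p 0 0 in let s2 := vS p 0 1 in let s3 := vS p 0 2 in
  let r1 := vR p 0 0 in let r2 := vR p 0 1 in let r3 := vR p 0 2 in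
  0 < a ->
  smooth_on (@range_aR3 R) g1 -> smooth_on (@range_aR3 R) g2 ->
  smooth_on (@range_aR3 R) g3 -> smooth_on (@range_aR3 R) V ->
  leaf a g p ->
  \rank (col_mx (sgrad (hamiltonian beta g1 g2 g3 V) p)
                (sgrad (@integralK R) p)) = 1%N <->
  [/\ r3 ^+ 2 < a, s1 * r2 - s2 * r1 = - (g1 (a, r3) * (a - r3 ^+ 2))
    & dWdx a g beta g1 g2 g3 V s3 r3 = 0].
Proof.
move=> s1 s2 s3 r1 r2 r3 a_gt0 sg1 sg2 sg3 sV leafp.
have := rank_eq0P beta a_gt0 sg1 sg2 sg3 sV leafp.
have [c [e []]] := sgrad_hamiltonian_leaf beta a_gt0 sg1 sg2 sg3 sV leafp.
have [] := (leafE _ _ _).1 leafp.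
rewrite -/s1 -/s2 -/s3 -/r1 -/r2 -/r3; move: (g1 (a, r3)) => G aE gE HE dWE rank0.
(* Where sgrad K = 0 both sides fail: the rank is 0, and R_3^2 = a. *)
have [K0|/eqP K_neq0] := eqVneq (sgrad (@integralK R) p) 0.
  have z := (sgrad_integralK_eq0 p).1 K0; rewrite rank0.2//.
  case: z => _ _; rewrite -/r1 -/r2 => r10 r20.
  by split=> // -[]; rewrite aE r10 r20 !expr0n !add0r ltxx.
have rho_neq0 : r3 ^+ 2 < a -> a - r3 ^+ 2 != 0 by move=> ?; rewrite subr_eq0 gt_eqF.
have rhoE : a - r3 ^+ 2 = r1 ^+ 2 + r2 ^+ 2 by rewrite aE addrK.
have gE' : g - s3 * r3 = s1 * r1 + s2 * r2 by rewrite gE addrK.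
rewrite rank_pair1; last exact/eqP.
rewrite HE sgrad_integralK -/s1 -/s2 -/r1 -/r2; split=> [[l]|[r3a L dW0]].
  rewrite scale_row_mx !scale_row3 => /row_mx_row3_inj[[e1 e2 _] [e4 e5 e6]].
  (* Otherwise R_1 = R_2 = 0 and R_3 != 0, so [e4] and [e5] become s2 r3 = 0 and s1 r3 = 0; the
     point is then on the axis, where sgrad K = 0. *)
  have r3a : r3 ^+ 2 < a.
    rewrite -subr_gt0 rhoE lt_def addr_ge0 ?sqr_ge0 // andbT.
    apply/eqP => /eqP; rewrite paddr_eq0 ?sqr_ge0// !sqrf_eq0.
    move=> /andP[/eqP r10 /eqP r20]; apply: K_neq0; apply/sgrad_integralK_eq0.
    have r3_neq0 : r3 != 0.
      by apply: contraTneq a_gt0 => r30; rewrite aE r10 r20 r30 !expr0n !add0r ltxx.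
    rewrite r10 r20 in e4 e5; split=> //; apply: (mulIf r3_neq0); rewrite -/s1 -/s2.
      by lra.
    by lra.
  have L : s1 * r2 - s2 * r1 = - (G * (a - r3 ^+ 2)) by rewrite rhoE; lra.
  split=> //; rewrite (dWE r3a L).
  apply: (mulfI (expf_neq0 2 (rho_neq0 r3a))); rewrite mulr0.
  have := rho_neq0 r3a; rewrite gE' rhoE => rho0.
  (* The unknown multiplier enters the equations only through this difference. [Qr3], the
     combination of [f4] and [f5] with weights r2 and r1, then determines it. *)
  pose d := c - l.
  have f4 : (s2 - G * r1) * r3 = d * r2 by rewrite /d; lra.
  have f5 : (s1 + G * r2) * r3 = d * r1 by rewrite /d; lra.
  have Qr3 : (s1 * r1 + s2 * r2) * r3 = d * (r1 ^+ 2 + r2 ^+ 2).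
    have -> : d * (r1 ^+ 2 + r2 ^+ 2) = d * r1 * r1 + d * r2 * r2 by ring.
    by rewrite -f4 -f5; ring.
  have f12 : d * (s1 * r1 + s2 * r2) - s3 * (s1 * r1 + s2 * r2)
      + G ^+ 2 * r3 * (r1 ^+ 2 + r2 ^+ 2) + e * (r1 ^+ 2 + r2 ^+ 2) = 0.
    (* This is r1 [e2] - r2 [e1]: the terms in s3 G cancel, and [e6] turns G r3 (s2 r1 - s1 r2) into
       G^2 r3 (r1^2 + r2^2). *)
    have := congr1 ( *%R r1) e2; have := congr1 ( *%R r2) e1.
    have := congr1 ( *%R (G * r3)) e6; rewrite mulr0 /d; lra.
  (* With denominators cleared and [Qr3] substituted, dW/dx becomes r1^2 + r2^2 times the left side
     of [f12]. *)
  have -> : (r1 ^+ 2 + r2 ^+ 2) ^+ 2 * (r3 * (s1 * r1 + s2 * r2) ^+ 2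
      / (r1 ^+ 2 + r2 ^+ 2) ^+ 2 - s3 * (s1 * r1 + s2 * r2)
      / (r1 ^+ 2 + r2 ^+ 2) + G ^+ 2 * r3 + e) =
      (s1 * r1 + s2 * r2) * ((s1 * r1 + s2 * r2) * r3)
      - s3 * (s1 * r1 + s2 * r2) * (r1 ^+ 2 + r2 ^+ 2)
      + (G ^+ 2 * r3 + e) * (r1 ^+ 2 + r2 ^+ 2) ^+ 2 by field.
  rewrite Qr3 -[RHS](mulr0 (r1 ^+ 2 + r2 ^+ 2)) -f12; ring.
move: dW0; rewrite (dWE r3a L) gE' rhoE.
move: L (rho_neq0 r3a); rewrite rhoE => L rho0.
(* The horizontal part of S is expanded in the orthogonal basis (r1, r2), (- r2, r1): its
   coefficients are [q] and, by [L], [G]. *)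
pose q := (s1 * r1 + s2 * r2) / (r1 ^+ 2 + r2 ^+ 2).
have s1E : s1 = q * r1 - G * r2.
  apply: (mulIf rho0); have := congr1 ( *%R^~ r2) L => /= Lr.
  have -> : (q * r1 - G * r2) * (r1 ^+ 2 + r2 ^+ 2) =
    (s1 * r1 + s2 * r2) * r1 - G * (r1 ^+ 2 + r2 ^+ 2) * r2.
    by rewrite /q; field.
  by lra.
have s2E : s2 = q * r2 + G * r1.
  apply: (mulIf rho0); have := congr1 ( *%R^~ r1) L => /= Lr.
  have -> : (q * r2 + G * r1) * (r1 ^+ 2 + r2 ^+ 2) =
    (s1 * r1 + s2 * r2) * r2 + G * (r1 ^+ 2 + r2 ^+ 2) * r1.
    by rewrite /q; field.
  by lra.
rewrite -exprVn -(mulrA _ (_ ^+ 2)) -exprMn -mulrA -/q => eE.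
have {}eE : e = - (r3 * q ^+ 2 - s3 * q + G ^+ 2 * r3) by lra.
(* The value forced by [Qr3] in the other direction: c - l = q r3. *)
exists (c - q * r3).
move: q s1E s2E eE => q -> -> ->.
by rewrite scale_row_mx !scale_row3; congr row_mx; congr row3; ring.
Qed.

(** * Values of the momentum mapping at singular points *)

(** Lagrange's identity gives (S_1^2 + S_2^2)(R_1^2 + R_2^2) = (S_1 R_1 + S_2 R_2)^2 + (S_1 R_2 -
    S_2 R_1)^2. So the kinetic term yields + g_1^2 (a - x^2) / 2 and the term linear in [g1] yields
    - g_1^2 (a - x^2), which together make the negative term of W. *)
Lemma hamiltonian_Wag {R : realType} {a g : R} (beta : R)
    (g1 g2 g3 V : R * R -> R) {p : phase R} :
  let s1 := vS p 0 0 in let s2 := vS p 0 1 in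
  let r1 := vR p 0 0 in let r2 := vR p 0 1 in let r3 := vR p 0 2 in
  leaf a g p -> r3 ^+ 2 < a ->
  s1 * r2 - s2 * r1 = - (g1 (a, r3) * (a - r3 ^+ 2)) ->
  hamiltonian beta g1 g2 g3 V p = Wag a g beta g1 g2 g3 V (vS p 0 2) r3.
Proof.
move=> s1 s2 r1 r2 r3 leafp r3a L; have [aE gE] := (leafE _ _ _).1 leafp.
rewrite /hamiltonian /Wag leafp.1 leafp.2 -/s1 -/s2 -/r1 -/r2 -/r3.
set s3 := vS p 0 2; set G := g1 (a, r3); rewrite L -/G; do 3 congr (_ + _).
have rho_neq0 : a - r3 ^+ 2 != 0 by rewrite subr_eq0 gt_eqF.
have sE : (s1 ^+ 2 + s2 ^+ 2) * (a - r3 ^+ 2) =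
    (g - s3 * r3) ^+ 2 + G ^+ 2 * (a - r3 ^+ 2) ^+ 2.
  have -> : G ^+ 2 * (a - r3 ^+ 2) ^+ 2 = (s1 * r2 - s2 * r1) ^+ 2.
    by rewrite L sqrrN exprMn.
  by rewrite gE aE -/r1 -/r2 -/r3 -/s1 -/s2 -/s3; ring.
have -> : s1 ^+ 2 + s2 ^+ 2 =
    ((g - s3 * r3) ^+ 2 + G ^+ 2 * (a - r3 ^+ 2) ^+ 2) / (a - r3 ^+ 2).
  by rewrite -sE mulfK.
rewrite [(2 * beta)^-1]invfM; move: beta^-1 => b.
by field.
Qed.

Lemma row_mx_row3P {R : realType} (p : phase R) :
  p = row_mx (row3 (vS p 0 0) (vS p 0 1) (vS p 0 2))
             (row3 (vR p 0 0) (vR p 0 1) (vR p 0 2)).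
Proof. by rewrite -!row3P hsubmxK. Qed.

Lemma row_mx_row3E {R : realType} (a b c d e f : R) :
  let p : phase R := row_mx (row3 a b c) (row3 d e f) in
  (vS p 0 0 = a) * (vS p 0 1 = b) * (vS p 0 2 = c) *
  (vR p 0 0 = d) * (vR p 0 1 = e) * (vR p 0 2 = f).
Proof. by rewrite /= /vS /vR row_mxKl row_mxKr !row3K. Qed.

(** Here [s] is a sign. On the axis R_3^2 = a and S_3 R_3 = g, and 1 / s = s gives the third
    component of S. *)
Definition pole {R : realType} (a g s : R) : phase R :=
  row_mx (row3 0 0 (s * (g / Num.sqrt a))) (row3 0 0 (s * Num.sqrt a)).

Lemma leaf_pole {R : realType} {a s : R} (g : R) :
  0 < a -> s ^+ 2 = 1 -> leaf a g (pole a g s).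
Proof.
move=> a_gt0 s2; have sqrta_neq0 : Num.sqrt a != 0 by rewrite sqrtr_eq0 -ltNge.
apply/leafE; rewrite /pole !row_mx_row3E !expr0n !mul0r !add0r.
rewrite exprMn sqr_sqrtr ?ltW// s2 mul1r mulrACA -expr2 s2 mul1r divfK//.
Qed.

Lemma leaf_axis {R : realType} {a g : R} {p : phase R} :
  0 < a -> leaf a g p ->
  [/\ vS p 0 0 = 0, vS p 0 1 = 0, vR p 0 0 = 0 & vR p 0 1 = 0] ->
  p = pole a g 1 \/ p = pole a g (-1).
Proof.
move=> a_gt0 /leafE[aE gE] [s1 s2 r1 r2].
have sqrta_neq0 : Num.sqrt a != 0 by rewrite sqrtr_eq0 -ltNge.
rewrite (row_mx_row3P p) s1 s2 r1 r2 /pole !mul1r.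
move: aE gE; rewrite s1 s2 r1 r2 !expr0n !mul0r !add0r.
move: (vS p 0 2) (vR p 0 2) => s3 r3 /eqP.
rewrite -{1}(sqr_sqrtr (ltW a_gt0)) eq_sym eqf_sqr => /orP[] /eqP -> ->.
  by left; rewrite mulfK.
by right; rewrite mulrN -mulNr mulfK// !mulN1r opprK.
Qed.

Lemma momentum_pole {R : realType} {a g beta s : R} (g1 g2 g3 V : R * R -> R) :
  0 < a -> s ^+ 2 = 1 ->
  momentum (hamiltonian beta g1 g2 g3 V) (@integralK R) (pole a g s) =
    Zpoint a g beta g2 g3 V s.
Proof.
move=> a_gt0 s2; have leafp := leaf_pole g a_gt0 s2.
rewrite /momentum /hamiltonian /integralK leafp.1 leafp.2.
rewrite /pole !row_mx_row3E /Zpoint.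
congr (_, _); do 2 congr (_ + _).
  rewrite exprMn s2 mul1r expr_div_n sqr_sqrtr ?ltW// !expr0n !mul0r subrr.
  rewrite mulr0 addr0 !add0r !invfM; ring.
exact: mulrC.
Qed.

(** * The bifurcation diagram *)

Theorem theorem4 (R : realType) (a g beta : R) (g1 g2 g3 V : R * R -> R)
    (a_gt0 : 0 < a) (beta_gt0 : 0 < beta)
    (g1_smooth : smooth_on (@range_aR3 R) g1)
    (g2_smooth : smooth_on (@range_aR3 R) g2)
    (g3_smooth : smooth_on (@range_aR3 R) g3)
    (V_smooth : smooth_on (@range_aR3 R) V) :
  let H := hamiltonian beta g1 g2 g3 V in
  let K := @integralK R in
  let Zp := Zpoint a g beta g2 g3 V 1 in
  let Zm := Zpoint a g beta g2 g3 V (-1) in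
  let curve := rank1_curve a g beta g1 g2 g3 V in
  [/\ bifurcation_diagram a g H K = [set Zp; Zm] `|` curve,
      exists Pp Pm : phase R,
        [/\ Pp <> Pm, rank_set a g H K 0 = [set Pp; Pm],
            momentum H K Pp = Zp & momentum H K Pm = Zm],
      Zp = Zm <-> g = 0 /\ V (a, Num.sqrt a) = V (a, - Num.sqrt a),
      momentum H K @` rank_set a g H K 1 = curve &
      forall x : R, x ^+ 2 < a -> exists A B C : R, (x != 0 -> A != 0) /\
        forall k : R, dWdx a g beta g1 g2 g3 V k x = A * k ^+ 2 + B * k + C].
Proof.
move=> H K Zp Zm curve.
have one2 : (1 : R) ^+ 2 = 1 by rewrite expr1n.
have mone2 : (-1 : R) ^+ 2 = 1 by rewrite sqrrN expr1n.
have sqrta_gt0 : 0 < Num.sqrt a by rewrite sqrtr_gt0.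
have rank0 p (leafp : leaf a g p) := rank_eq0P beta a_gt0 g1_smooth g2_smooth
  g3_smooth V_smooth leafp.
have rank1 p (leafp : leaf a g p) := rank_eq1P beta a_gt0 g1_smooth g2_smooth
  g3_smooth V_smooth leafp.
have rank_set0E : rank_set a g H K 0 = [set pole a g 1; pole a g (-1)].
  apply/seteqP; split=> [p [leafp /(rank0 p leafp)]|p poleP].
    exact: leaf_axis.
  have [leafp axis] : leaf a g p /\
      [/\ vS p 0 0 = 0, vS p 0 1 = 0, vR p 0 0 = 0 & vR p 0 1 = 0].
    by case: poleP => ->; (split; first exact: leaf_pole);
      rewrite /pole !row_mx_row3E.
  by split=> //; apply/rank0.
have mom_p : momentum H K (pole a g 1) = Zp by exact: momentum_pole.
have mom_m : momentum H K (pole a g (-1)) = Zm by exact: momentum_pole.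
have rank_set1E : momentum H K @` rank_set a g H K 1 = curve.
  apply/seteqP; split=> [_ [p [leafp /(rank1 p leafp)[r3a L dW]] <-]|].
    exists (vR p 0 2), (vS p 0 2); split=> //.
    by rewrite /momentum /H (hamiltonian_Wag _ _ _ _ _ leafp r3a L).
  move=> _ [x [k [x2a dW ->]]].
  have rho_gt0 : 0 < a - x ^+ 2 by rewrite subr_gt0.
  pose rho := Num.sqrt (a - x ^+ 2).
  have rho_neq0 : rho != 0 by rewrite gt_eqF// sqrtr_gt0.
  have rho2 : rho ^+ 2 = a - x ^+ 2 by rewrite sqr_sqrtr// ltW.
  (* A rotation about the third axis allows R_2 = 0 and R_1 = rho > 0. Then <S,R> = g fixes S_1, and
     the relation [L] fixes S_2. *)
  pose p : phase R := row_mx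
    (row3 ((g - k * x) / rho) (g1 (a, x) * rho) k) (row3 rho 0 x).
  have leafp : leaf a g p.
    apply/leafE; rewrite /p !row_mx_row3E rho2 divfK//.
    by split; ring.
  have L : vS p 0 0 * vR p 0 1 - vS p 0 1 * vR p 0 0 =
      - (g1 (a, vR p 0 2) * (a - vR p 0 2 ^+ 2)).
    by rewrite /p !row_mx_row3E -rho2; ring.
  have x2a' : vR p 0 2 ^+ 2 < a by rewrite row_mx_row3E.
  exists p.
    split=> //; apply/(rank1 p leafp); split=> //.
    by rewrite !row_mx_row3E.
  rewrite /momentum /H (hamiltonian_Wag _ _ _ _ _ leafp x2a' L) /K /integralK.
  by rewrite !row_mx_row3E.
split=> //.
- rewrite /bifurcation_diagram image_setU rank_set1E rank_set0E.
  by rewrite image_setU !image_set1 mom_p mom_m.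
- exists (pole a g 1), (pole a g (-1)); split=> // /(congr1 (fun p => vR p 0 2)).
  by rewrite /pole !row_mx_row3E mul1r mulN1r; lra.
- rewrite /Zp /Zm /Zpoint !mul1r !mulN1r; split=> [[hE kE]|[-> ->]].
    (* The k-coordinates are opposite, so their equality forces g = 0; all terms of h except V then
       vanish. *)
    have g0 : g = 0.
      have : g / Num.sqrt a = 0 by lra.
      by move/eqP; rewrite mulf_eq0 invr_eq0 (gt_eqF sqrta_gt0) orbF => /eqP.
    by split=> //; move: hE; rewrite g0 !mul0r oppr0 !mul0r; lra.
  by rewrite !mul0r oppr0 !mul0r.
- move=> x x2a.
  have Dp : range_aR3 (a, x) by split=> //=; exact: ltW.
  have [ga1 [gx1 dg1]] := smooth_on_has_partials g1_smooth Dp.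
  have [ga2 [gx2 dg2]] := smooth_on_has_partials g2_smooth Dp.
  have [ga3 [gx3 dg3]] := smooth_on_has_partials g3_smooth Dp.
  have [Va [Vx dV]] := smooth_on_has_partials V_smooth Dp.
  have rho_neq0 : a - x ^+ 2 != 0 by rewrite subr_eq0 gt_eqF.
  (* Over the common denominator (a - x^2)^2 the coefficient of k^2 is x^3 + x (a - x^2) = x a, and
     the part of the coefficient of k containing g is - g (2 x^2 + a - x^2). The equation is thus
     linear exactly at x = 0. *)
  exists (x * a / (a - x ^+ 2) ^+ 2),
    (gx3 - g * (a + x ^+ 2) / (a - x ^+ 2) ^+ 2),
    (x * g ^+ 2 / (a - x ^+ 2) ^+ 2 + g1 (a, x) ^+ 2 * x
     - g1 (a, x) * gx1 * (a - x ^+ 2) + gx2 * g + Vx).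
  split=> [x_neq0|k]; first by rewrite !mulf_neq0 ?invr_eq0 ?expf_neq0// gt_eqF.
  by rewrite (derive1_Wag k x2a dg1 dg2 dg3 dV); field.
Qed.
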